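(* Let $r,k\in\mathbb{N}$ and let $\mathscr{C}$ be a nowhere dense graph class. Then there exists $p\in\mathbb{N}$, depending on $r$, $k$ and $\mathscr{C}$, such that if $G\in\mathscr{C}$ does not contain a distance-$r$ independent set of size $k$, then $G$ has a distance-$r$ dependence core for $k$ of size at most $p$.
   Context: A set $A\subseteq V(G)$ is distance-$r$ independent if $\mathrm{dist}_G(u,v)>r$ for all distinct $u,v\in A$. A distance-$r$ dependence core for $G$ and $k$ is a set $Q\subseteq V(G)$ such that for every set $X\subseteq V(G)$ of size $k$ there exists a path of length at most $r$ that contains a vertex of $Q$ and connects two distinct elements of $X$. A graph class $\mathscr{C}$ is nowhere dense if for every $r'\in\mathbb{N}$ there is $t$ such that no graph in $\mathscr{C}$ contains a subgraph from which $K_t$ can be obtained by contracting pairwise disjoint connected subgraphs of radius at most $r'$.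
   Formalization: In the dependence core, the connecting path of length at most r may repeat vertices (a walk); with simple paths the claim fails, e.g. for stars with every edge subdivided once, r=4, k=2. *)

(* Defs.v *)
From mathcomp Require Import all_boot.

Set Implicit Arguments.
Unset Strict Implicit.
Unset Printing Implicit Defensive.

Record sgraph := SGraph {
  vertex :> finType;
  edge : rel vertex;
  edge_sym : symmetric edge;
  edge_irrefl : irreflexive edge }.

(* The walk u, p_0, p_1, ... ends at v; its length is [size p].  Vertices may
   be repeated. *)
Definition walk (G : sgraph) (u v : G) (p : seq G) : bool :=
  path (@edge G) u p && (last u p == v).

Definition walk_of_length (G : sgraph) (u v : G) (n : nat) : bool :=
  [exists p : n.-tuple G, walk u v p].

Lemma connect_walk_of_length (G : sgraph) (u v : G) :
  connect (@edge G) u v -> exists n, walk_of_length u v n.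
Proof.
case/connectP => p pth eqv; exists (size p).
by apply/existsP; exists (in_tuple p); rewrite /walk /= pth eqv eqxx.
Qed.

(* [None] stands for an infinite distance. *)
Definition dist (G : sgraph) (u v : G) : option nat :=
  if decP (@idP (connect (@edge G) u v)) is left uv
  then Some (ex_minn (connect_walk_of_length uv)) else None.

Definition dist_gt (G : sgraph) (r : nat) (u v : G) : bool :=
  if dist u v is Some d then r < d else true.

Definition dist_le (G : sgraph) (r : nat) (u v : G) : bool :=
  if dist u v is Some d then d <= r else false.

Definition distance_independent (G : sgraph) (r : nat) (A : {set G}) : Prop :=
  {in A &, forall u v, u != v -> dist_gt r u v}.

(* The connecting path may revisit vertices: the condition says that
   dist(u, q) + dist(q, v) <= r for some q in Q and distinct u, v in X.
   Requiring simple paths would be strictly stronger, and would leave stars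
   with every edge subdivided once without bounded cores for r = 4, k = 2. *)
Definition dependence_core (G : sgraph) (r k : nat) (Q : {set G}) : Prop :=
  forall X : {set G}, #|X| = k ->
  exists u v : G, exists p : seq G,
    [/\ [/\ u \in X, v \in X & u != v],
        walk u v p, size p <= r & has [in Q] (u :: p)].

Definition complete_edge (t : nat) : rel 'I_t := fun i j => i != j.

Lemma complete_edge_sym t : symmetric (@complete_edge t).
Proof. by move=> i j; rewrite /complete_edge eq_sym. Qed.

Lemma complete_edge_irrefl t : irreflexive (@complete_edge t).
Proof. by move=> i; rewrite /complete_edge eqxx. Qed.

Definition complete_graph (t : nat) : sgraph :=
  SGraph (@complete_edge_sym t) (@complete_edge_irrefl t).

(* H, through the embedding f, is a (not necessarily induced) subgraph of G. *)
Definition subgraph_embedding (H G : sgraph) (f : H -> G) : Prop :=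
  injective f /\ {homo f : u v / edge u v}.

Definition is_subgraph (H G : sgraph) : Prop :=
  exists f : H -> G, subgraph_embedding f.

(* This makes G nonempty and connected. *)
Definition radius_le (G : sgraph) (d : nat) : Prop :=
  exists c : G, forall v : G, dist_le d c v.

(* f sends each vertex of H to the vertex of M it is contracted to; vertices
   that are not contracted form subgraphs of radius 0.  Surjectivity of f
   follows from the nonemptiness of each D. *)
Definition contracts_to (d : nat) (H M : sgraph) : Prop :=
  exists f : H -> M,
    (forall m : M, exists D : sgraph, exists g : D -> H,
       [/\ subgraph_embedding g, radius_le D d
         & g @: [set: D] = [set x | f x == m]]) /\
    (forall m m' : M, edge m m' <->
       m != m' /\ exists u v : H, [/\ f u = m, f v = m' & edge u v]).

Definition nowhere_dense (C : sgraph -> Prop) : Prop :=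
  forall d : nat, exists t : nat, forall G : sgraph, C G ->
    ~ exists H : sgraph, is_subgraph H G /\ contracts_to d H (complete_graph t).

(* Main.v *)
Require Import Defs.
From mathcomp Require Import all_boot zify.

(** Suppose that no small core exists.  Choose k-sets X_0, X_1, ... so that X_j
    is not connected by any vertex of Q_j, where Q_j contains, for all earlier
    i1, i2, i3 and all coordinates a, b, a vertex on short connections between
    the a-th and b-th elements of X_i1, X_i2 and X_i3, if there is one.  Uniform
    quasi-wideness and the pigeonhole principle give a bounded set S and many
    X_i that are pairwise far apart in G - S and have the same distances to S.
    The diagonal set made of the a-th element of the a-th X_i is not
    independent, so two of its elements, with coordinates a and b, are close;
    they are close through some u in S, which then connects the coordinates a
    and b of all the X_i.  Hence Q_j, for j the fourth index, contains a vertex w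
    connecting the first three X_i, and, again because distances to w are
    realized through S, it connects X_j as well: a contradiction.

    Uniform quasi-wideness is proved by increasing the radius of disjoint balls
    by one at a time.  By Ramsey's theorem for triples, either many enlarged
    balls are disjoint, or there is a shallow subdivided clique, or one vertex
    touches many balls.  In the last case this vertex is put into S; this
    cannot happen t times, as it would create a shallow biclique. *)

Set Implicit Arguments.
Unset Strict Implicit.
Unset Printing Implicit Defensive.

(** * Ramsey's theorem *)

(* Hypergraph Ramsey with subsequences instead of subsets; the target sizes
   depend on the color so that one can induct on their sum. *)
Lemma ramsey_sum (C : finType) n M : exists N, forall (f : seq nat -> C) (m : C -> nat) s,
  \sum_c m c <= M -> N <= size s ->
  exists c s', [/\ subseq s' s, size s' = m c &
    forall u, subseq u s' -> size u = n -> f u = c].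
Proof.
elim: n M => [|n IHn] M.
  exists M => f m s mM sM; exists (f [::]), (take (m (f [::])) s); split.
  - exact: take_subseq.
  - apply: size_takel; apply: leq_trans sM; apply: leq_trans mM.
    by rewrite (bigD1 (f [::])) //= leq_addr.
  - by move=> u _ /size0nil ->.
elim: M => [|M [N HN]].
  exists 0 => f m s; rewrite leqn0 sum_nat_eq0 => /forallP m0 _.
  exists (f [::]), [::]; split; first exact: sub0seq.
    by rewrite (eqP (m0 _)).
  by move=> u; rewrite subseq0 => /eqP ->.
(* The head [x] is set aside and the tail thinned to [t], on which all [x :: u] have one color [c].
   The target for [c] then drops by one, since [x] can be put in front of a sequence of color
   [c]. *)
have [N' HN'] := IHn (#|C| * N).
exists N'.+1 => f m [|x s] // mM; rewrite ltnS => sN'.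
have [|c [t [ts tN ft]]] := HN' (fun u => f (x :: u)) (fun=> N) s _ sN'.
  by rewrite sum_nat_const.
have [m0|m_gt0] := posnP (m c).
  exists c, [::]; split; [exact: sub0seq | by rewrite m0 |].
  by move=> u; rewrite subseq0 => /eqP ->.
pose m' c' := if c' == c then (m c).-1 else m c'.
have [||c' [s' [s't s'm fs']]] := HN f m' t; rewrite ?tN //.
  move: mM; rewrite (bigD1 c) //= -(prednK m_gt0) addSn ltnS; apply: leq_trans.
  rewrite [X in X <= _](bigD1 c) //= /m' eqxx leq_add2l; apply: leq_sum => i /negPf ->.
  exact: leqnn.
have s's := subseq_trans s't ts.
case: (eqVneq c' c) s'm fs' => [->|c'c]; rewrite /m' => s'm fs'.
  rewrite ?eqxx in s'm.
  exists c, (x :: s'); split; first by rewrite /= eqxx.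
    by rewrite /= s'm prednK.
  move=> [|y u] //= + [un]; case: eqP => [-> us'|_ us']; last by apply: fs' => //=; rewrite un.
  by apply: ft un; apply: subseq_trans s't.
rewrite (negPf c'c) in s'm.
exists c', s'; split => //; exact: subseq_trans s's (subseq_cons _ _).
Qed.

Lemma ramsey (C : finType) n m : exists N, forall (f : seq nat -> C) s,
  N <= size s -> exists c s', [/\ subseq s' s, size s' = m &
    forall u, subseq u s' -> size u = n -> f u = c].
Proof.
have [N HN] := ramsey_sum C n (#|C| * m).
by exists N => f s; apply: (HN f (fun=> m)); rewrite sum_nat_const.
Qed.

Lemma subseq_nths (T : eqType) (x0 : T) (s : seq T) ps :
  sorted ltn ps -> all (gtn (size s)) ps -> subseq (map (nth x0 s) ps) s.
Proof.
move=> srt /allP lt_ps; rewrite -[X in subseq _ X](mkseq_nth x0); apply: map_subseq.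
have -> : ps = filter (mem ps) (iota 0 (size s)).
  apply: (irr_sorted_eq ltn_trans ltnn) => //.
    by apply: sorted_filter; [exact: ltn_trans | exact: iota_ltn_sorted].
  move=> i; rewrite mem_filter mem_iota /= add0n.
  by case: (boolP (i \in ps)) => // /lt_ps.
exact: filter_subseq.
Qed.

Lemma ramsey1 (C : finType) m : exists N, forall (f : nat -> C) s,
  N <= size s -> exists c s', [/\ subseq s' s, size s' = m & {in s', forall i, f i = c}].
Proof.
have [N HN] := ramsey C 1 m; exists N => f s /(HN (fun u => f (head 0 u))).
move=> [c [s' [s's s'm fs']]]; exists c, s'; split=> // i.
by rewrite -sub1seq => /fs'; apply.
Qed.

Lemma ramsey2 (C : finType) m : exists N, forall (f : nat -> nat -> C) s,
  N <= size s -> exists c s', [/\ subseq s' s, size s' = m &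
    forall p q, p < q < m -> f (nth 0 s' p) (nth 0 s' q) = c].
Proof.
have [N HN] := ramsey C 2 m.
exists N => f s /(HN (fun u => f (nth 0 u 0) (nth 0 u 1))).
move=> [c [s' [s's s'm fs']]]; exists c, s'; split=> // p q /andP[pq qm].
apply: (fs' (map (nth 0 s') [:: p; q])) => //; apply: subseq_nths => //=.
  by rewrite pq.
by rewrite s'm qm (ltn_trans pq qm).
Qed.

Lemma ramsey3 (C : finType) m : exists N, forall (f : nat -> nat -> nat -> C) s,
  N <= size s -> exists c s', [/\ subseq s' s, size s' = m &
    forall p q l, p < q -> q < l -> l < m ->
      f (nth 0 s' p) (nth 0 s' q) (nth 0 s' l) = c].
Proof.
have [N HN] := ramsey C 3 m.
exists N => f s /(HN (fun u => f (nth 0 u 0) (nth 0 u 1) (nth 0 u 2))).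
move=> [c [s' [s's s'm fs']]]; exists c, s'; split=> // p q l pq ql lm.
apply: (fs' (map (nth 0 s') [:: p; q; l])) => //; apply: subseq_nths => //=.
  by rewrite pq ql.
by rewrite s'm lm (ltn_trans ql lm) (ltn_trans pq (ltn_trans ql lm)).
Qed.

(** * Balls *)

Section Ball.
Variable G : sgraph.
Implicit Types (A B S : {set G}) (x y u v w : G).

(** These are balls in the subgraph induced by [A]. Growing them layer by layer turns arguments on
    distances into inductions on the radius; [ball_walkP] gives the link with walks. *)
Fixpoint ball A x n : {set G} :=
  if n is n'.+1
  then ball A x n' :|: [set v in A | [exists u in ball A x n', edge u v]]
  else A :&: [set x].

Lemma ball0E A x v : (v \in ball A x 0) = (v \in A) && (v == x).
Proof. by rewrite /= !inE. Qed.

Lemma ballSP A x n v :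
  reflect (v \in ball A x n \/ exists u, [/\ u \in ball A x n, v \in A & edge u v])
          (v \in ball A x n.+1).
Proof.
rewrite /= !inE; apply: (iffP orP) => -[]; try by left.
  by move=> /andP[vA /existsP[u /andP[ux uv]]]; right; exists u.
by move=> [u [ux vA uv]]; right; rewrite vA; apply/existsP; exists u; rewrite ux.
Qed.

Lemma ball_sub A x n v : v \in ball A x n -> v \in A.
Proof.
by elim: n v => [v|n IH v /ballSP[/IH //|[u []]]//]; rewrite ball0E => /andP[].
Qed.

Lemma ball_leq A x n m v : n <= m -> v \in ball A x n -> v \in ball A x m.
Proof.
move=> /subnK <-; elim: (m - n) => // l IH /IH vx.
by rewrite addSn; apply/ballSP; left.
Qed.

(** Only the ball has to lie in [B], not all of [A]. With [B] built from the ball itself, this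
    bounds the radius of a branch set measured inside it. *)
Lemma ball_subset A B x n v :
  ball A x n \subset B -> v \in ball A x n -> v \in ball B x n.
Proof.
elim: n v => [|n IH] v /subsetP AB; first by rewrite !ball0E => vx; rewrite AB ?ball0E //; case/andP: vx.
have {}IH u : u \in ball A x n -> u \in ball B x n.
  by apply: IH; apply/subsetP => z zx; apply: AB; apply: ball_leq zx.
move=> vx; have vB := AB _ vx.
by case/ballSP: vx => [/IH vx|[u [/IH ux _ uv]]]; apply/ballSP; [left|right; exists u].
Qed.

Lemma ballS A B x n v : A \subset B -> v \in ball A x n -> v \in ball B x n.
Proof.
move=> AB; apply: ball_subset; apply: subset_trans AB.
by apply/subsetP => u /ball_sub.
Qed.

Lemma ball_center A x n : x \in A -> x \in ball A x n.
Proof. by move=> xA; apply: (@ball_leq _ _ 0) => //; rewrite !inE xA eqxx. Qed.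

Lemma ball_center_in A x n v : v \in ball A x n -> x \in A.
Proof.
elim: n v => [|n IH] v; first by rewrite ball0E => /andP[vA /eqP <-].
by case/ballSP => [/IH//|[u [/IH]]].
Qed.

Lemma ball_trans A x v w n m :
  v \in ball A x n -> w \in ball A v m -> w \in ball A x (n + m).
Proof.
move=> vx; elim: m w => [|m IH] w.
  by rewrite ball0E addn0 => /andP[_ /eqP ->].
by rewrite addnS; case/ballSP => [/IH|[u [/IH ux wA uw]]] *; apply/ballSP;
  [left | right; exists u].
Qed.

Lemma ball_sym A x v n : v \in ball A x n -> x \in ball A v n.
Proof.
elim: n v => [|n IH] v.
  by rewrite !ball0E => /andP[vA /eqP <-]; rewrite vA eqxx.
case/ballSP => [/IH|[u [ux vA uv]]]; first exact: ball_leq.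
rewrite -add1n; apply: ball_trans (IH _ ux); apply/ballSP; right; exists v.
by rewrite ball_center // (ball_sub ux) edge_sym.
Qed.

(** A short walk avoids [S] or can be split at a vertex of [S]. In the second case only distances to
    [S] matter, and these can be made equal by pigeonhole. *)
Lemma ball_avoid S x v n : v \in ball [set: G] x n ->
  v \in ball (~: S) x n \/ exists s d1 d2, [/\ s \in S, d1 + d2 <= n,
    s \in ball [set: G] x d1 & v \in ball [set: G] s d2].
Proof.
have ballT y m : y \in ball setT y m by apply: ball_center; rewrite inE.
elim: n v => [|n IH] v.
  rewrite !ball0E !inE /= => /eqP ->; case: (boolP (x \in S)) => xS; last by left; rewrite eqxx.
  by right; exists x, 0, 0.
case/ballSP => [/IH[vx|[s [d1 [d2 [sS d12 sx vs]]]]]|[u [/[dup] uxT /IH ux _ uv]]].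
- by left; apply: ball_leq vx.
- by right; exists s, d1, d2; split=> //; apply: leqW.
case: ux => [ux|[s [d1 [d2 [sS d12 sx us]]]]].
  case: (boolP (v \in S)) => vS; last by left; apply/ballSP; right; exists u; rewrite inE.
  right; exists v, n.+1, 0; split=> //; first by rewrite addn0.
  by apply/ballSP; right; exists u.
right; exists s, d1, d2.+1; rewrite addnS ltnS; split=> //.
by apply/ballSP; right; exists u.
Qed.

Lemma ball_walkP A x v n : x \in A ->
  reflect (exists p, [/\ walk x v p, size p <= n & all [in A] p]) (v \in ball A x n).
Proof.
move=> xA; apply: (iffP idP).
  elim: n v => [|n IH] v.
    by rewrite ball0E => /andP[_ /eqP ->]; exists [::]; rewrite /walk /= eqxx.
  case/ballSP => [/IH[p [xp pn pA]]|[u [/IH[p [/andP[xp /eqP pu] pn pA]] vA uv]]].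
    by exists p; split=> //; apply: leqW.
  exists (rcons p v); rewrite size_rcons all_rcons pA vA; split=> //.
  by rewrite /walk rcons_path last_rcons xp pu uv eqxx.
move=> [p []]; elim/last_ind: p v n => [|p u IH] v n.
  by rewrite /walk /= => /eqP <- _ _; apply: ball_center.
rewrite /walk rcons_path last_rcons size_rcons all_rcons.
move=> /andP[/andP[xp pu] /eqP <-]; case: n => // n pn /andP[uA pA].
apply/ballSP; right; exists (last x p); split=> //.
by apply: IH => //; rewrite /walk xp eqxx.
Qed.

Lemma walk_dist_le u v p n : walk u v p -> size p <= n -> dist_le n u v.
Proof.
move=> uvp pn; rewrite /dist_le /dist; case: decP => [uv|[]]; last first.
  by case/andP: uvp => up /eqP <-; apply/connectP; exists p.
case: ex_minnP => d _ min_d; apply: leq_trans pn; apply: min_d.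
by apply/existsP; exists (in_tuple p).
Qed.

Lemma ball_dist_gt u v n : v \notin ball [set: G] u n -> dist_gt n u v.
Proof.
rewrite /dist_gt /dist; case: decP => // uv; case: ex_minnP => d + _.
case/existsP => p uvp; apply: contraR; rewrite -leqNgt => dn.
by apply/ball_walkP; rewrite ?inE //; exists p; rewrite size_tuple; split=> //; apply/allP.
Qed.

End Ball.

(** * Shallow clique minors *)

Section Minor.
Variable G : sgraph.

Definition induced_edge (B : {set G}) : rel {x : G | x \in B} := relpre val (@edge G).

Lemma induced_edge_sym B : symmetric (@induced_edge B).
Proof. by move=> x y; rewrite /induced_edge /= edge_sym. Qed.

Lemma induced_edge_irrefl B : irreflexive (@induced_edge B).
Proof. by move=> x; rewrite /induced_edge /= edge_irrefl. Qed.

Definition induced B := SGraph (@induced_edge_sym B) (@induced_edge_irrefl B).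

Lemma induced_radius (B : {set G}) (c : G) d : c \in B ->
  (forall v, v \in B -> v \in ball B c d) -> radius_le (induced B) d.
Proof.
move=> cB Bd; exists (Sub c cB : induced B) => v.
have /ball_walkP[//|p [/andP[cp /eqP pv] pd pB]] := Bd (val v) (valP v).
have [q pq] : exists q : seq (induced B), p = map val q.
  elim: p pB {cp pv pd} => [|y p IH] /=; first by exists [::].
  by move=> /andP[yB /IH[q ->]]; exists (Sub y yB :: q).
have cE : c = val (Sub c cB : induced B) by [].
rewrite pq size_map in pd; rewrite pq cE path_map in cp; rewrite pq cE last_map in pv.
apply: (@walk_dist_le (induced B) _ _ q) pd; rewrite /walk cp /=; apply/eqP; exact: val_inj.
Qed.

(** The subgraph to contract is induced by the union of the [B i], so that every vertex has a branch
    set to be mapped to. *)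
Lemma shallow_clique_minor d t (B : 'I_t -> {set G}) (c : 'I_t -> G) :
  (forall i, c i \in B i) ->
  (forall i, forall v, v \in B i -> v \in ball (B i) (c i) d) ->
  (forall i j v, v \in B i -> v \in B j -> i = j) ->
  (forall i j : 'I_t, i < j -> exists u v, [/\ u \in B i, v \in B j & edge u v]) ->
  exists H, is_subgraph H G /\ contracts_to d H (complete_graph t).
Proof.
move=> cB Bd Bdisj Bedge; pose V := \bigcup_i B i.
have BV i v : v \in B i -> v \in V by move=> vi; apply/bigcupP; exists i.
exists (induced V); split.
  by exists val; split=> //; apply: val_inj.
have fP (x : induced V) : exists i, val x \in B i.
  by case/bigcupP: (valP x) => i _ xi; exists i.
pose f x := xchoose (fP x); have fB x : val x \in B (f x) := xchooseP (fP x).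
have fE x i : val x \in B i -> f x = i by apply: Bdisj.
exists f; split=> [i|i j].
  exists (induced (B i)), (fun x : induced (B i) => Sub (val x) (BV i _ (valP x)) : induced V).
  split; first by split=> [x y /(congr1 val) /= /val_inj|].
    exact: induced_radius (cB i) (Bd i).
  apply/setP => x; rewrite inE; apply/imsetP/eqP => [[y _ ->]|fx].
    by apply: fE; rewrite SubK; exact: valP y.
  have xi : val x \in B i by rewrite -fx.
  by exists (Sub (val x) xi : induced (B i)) => //; apply: val_inj.
split=> [ij|[]//]; split=> //.
have {}Bedge : exists u v, [/\ u \in B i, v \in B j & edge u v].
  case: (ltngtP (i : nat) j) => [/Bedge//|/Bedge[u [v [uj vi uv]]]|/val_inj eij].
    by exists v, u; rewrite edge_sym.
  by rewrite /= /complete_edge eij eqxx in ij.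
move: Bedge => [u [v [ui vj uv]]].
by exists (Sub u (BV _ _ ui)), (Sub v (BV _ _ vj)); split=> //; apply: fE.
Qed.

(** Common frame for bicliques and subdivided cliques: each branch set is a ball enlarged by
    vertices at most one step further out. *)
Lemma clique_minor_of_balls (A : {set G}) d t (c : 'I_t -> G) (Z : 'I_t -> {set G}) :
  (forall i, c i \in A) ->
  (forall i, Z i \subset ball A (c i) d.+1) ->
  (forall i j v, v \in ball A (c i) d -> v \in ball A (c j) d -> i = j) ->
  (forall i j v, v \in Z i -> v \in ball A (c j) d -> i = j) ->
  (forall i j v, v \in Z i -> v \in Z j -> i = j) ->
  (forall i j : 'I_t, i < j -> exists u v,
     [/\ u \in ball A (c i) d :|: Z i, v \in ball A (c j) d :|: Z j & edge u v]) ->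
  exists H, is_subgraph H G /\ contracts_to d.+1 H (complete_graph t).
Proof.
move=> cA Zd BB ZB ZZ; apply: (@shallow_clique_minor _ _ _ c) => [i|i v|i j v].
- by rewrite inE ball_center.
- have subB u : u \in ball A (c i) d -> u \in ball (ball A (c i) d :|: Z i) (c i) d.
    by apply: ball_subset; apply: subsetUl.
  move=> /[dup] vU; rewrite inE => /orP[/subB|vZ]; first exact: ball_leq.
  have /ballSP[/subB|[u [/subB uc _ uv]]] := subsetP (Zd i) v vZ; first exact: ball_leq.
  by apply/ballSP; right; exists u.
- rewrite !inE => /orP[vi|vi] /orP[vj|vj]; [exact: BB vi vj | | exact: ZB vi vj | exact: ZZ vi vj].
  by apply/esym; apply: ZB vj vi.
Qed.

End Minor.

(** * Uniform quasi-wideness *)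

Definition shallow_free d t (G : sgraph) : Prop :=
  ~ exists H : sgraph, is_subgraph H G /\ contracts_to d H (complete_graph t).

(* The ball around x i is empty when x i is not in A: this is how centers that
   are themselves deleted, and repeated centers, are accommodated. *)
Definition scattered (G : sgraph) (A : {set G}) (x : nat -> G) d (s : seq nat) : Prop :=
  forall i j v, i \in s -> j \in s ->
    v \in ball A (x i) d -> v \in ball A (x j) d -> i = j.

Lemma scattered_sub (G : sgraph) (A A' : {set G}) x d d' s s' :
  A' \subset A -> d' <= d -> {subset s' <= s} ->
  scattered A x d s -> scattered A' x d' s'.
Proof.
move=> AA dd ss sc i j v /ss si /ss sj vi vj.
by apply: (sc _ _ v) => //; apply: ballS AA _; apply: ball_leq dd _.
Qed.

(* Each w in ws joins one ball and is adjacent to all the others. *)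
Lemma biclique_not_free (G : sgraph) (A : {set G}) d t x s ws :
  uniq s -> uniq ws -> t <= size s -> size ws = t -> scattered A x d s ->
  (forall w i, w \in ws -> i \in s ->
     w \in ball A (x i) d.+1 /\ w \notin ball A (x i) d) ->
  ~ shallow_free d.+1 t G.
Proof.
move=> us uws ts wst sc touch; apply.
have sP (l : 'I_t) : nth 0 s l \in s by rewrite mem_nth // (leq_trans _ ts).
have wP (l : 'I_t) : nth (x 0) ws l \in ws by rewrite mem_nth // wst.
apply: (@clique_minor_of_balls _ A _ _ (fun l => x (nth 0 s l))
  (fun l => [set nth (x 0) ws l])) => [i|i|i j v vi vj|i j v|i j v|i j ij].
- by have [/ball_center_in] := touch _ _ (wP i) (sP i).
- by rewrite sub1set; have [] := touch _ _ (wP i) (sP i).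
- apply/val_inj/eqP; rewrite -(nth_uniq 0 _ _ us) ?(leq_trans (ltn_ord _) ts) //.
  by apply/eqP; apply: sc vi vj.
- by move=> /set1P ->; have [_ /negPf ->] := touch _ _ (wP i) (sP j).
- move=> /set1P -> /set1P /eqP; rewrite nth_uniq ?wst ?ltn_ord // => /eqP.
  exact: val_inj.
have [/ballSP[->|[u [uj _ uw]]] Nw] // := touch _ _ (wP i) (sP j).
by exists (nth (x 0) ws i), u; rewrite !inE eqxx uj orbT edge_sym.
Qed.

(* w p q links the p-th and q-th balls and stays away from all the others; it
   joins the p-th ball, unless it already lies in the q-th. *)
Lemma subdivision_not_free (G : sgraph) (A : {set G}) d t x s (w : nat -> nat -> G) :
  uniq s -> t <= size s -> scattered A x d s ->
  (forall p, p < t -> x (nth 0 s p) \in A) ->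
  (forall p q l, p < q < t -> l < t ->
     (w p q \in ball A (x (nth 0 s l)) d.+1) = (l == p) || (l == q)) ->
  ~ shallow_free d.+1 t G.
Proof.
move=> us ts sc xA wN; apply.
have sP (l : 'I_t) : nth 0 s l \in s by rewrite mem_nth // (leq_trans _ ts).
have sI (i j : 'I_t) v : v \in ball A (x (nth 0 s i)) d ->
  v \in ball A (x (nth 0 s j)) d -> i = j.
  move=> vi vj; apply/val_inj/eqP; rewrite -(nth_uniq 0 _ _ us) ?(leq_trans (ltn_ord _) ts) //.
  by apply/eqP; apply: sc vi vj.
apply: (@clique_minor_of_balls _ A _ _ (fun l => x (nth 0 s l))
  (fun p : 'I_t => [set w p q | q : 'I_t &
     (p < q) && (w p q \notin ball A (x (nth 0 s q)) d)]))
  => [i|i|//|i j v|i j v|i j ij].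
- exact: xA.
- apply/subsetP => v /imsetP[q]; rewrite inE => /andP[iq _] ->.
  by rewrite wN ?iq ?eqxx /=.
- case/imsetP => q; rewrite inE => /andP[iq wq] -> wj; apply/val_inj/eqP.
  have := ball_leq (leqnSn d) wj; rewrite wN ?iq /= // eq_sym => /orP[//|/eqP].
  by move=> /val_inj jq; rewrite jq (negPf wq) in wj.
- case/imsetP => q; rewrite inE => /andP[iq _] ->.
  case/imsetP => q'; rewrite inE => /andP[jq' _] ew.
  (* The vertex determines the two balls that it touches, and both [i] and [j] are the smaller of
     their indices. *)
  have := wN i q j; rewrite iq /= ew !wN ?jq' ?eqxx !ltn_ord //= => /(_ isT isT).
  have := wN j q' i; rewrite jq' /= -ew !wN ?iq ?eqxx !ltn_ord //= => /(_ isT isT).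
  move=> /esym/orP[/eqP/val_inj// | /eqP/val_inj iq'].
  move=> /esym/orP[/eqP/val_inj// | /eqP/val_inj jq]; rewrite -iq' -?jq in jq' iq.
  by have := ltn_trans iq jq'; rewrite ltnn.
have ijt : i < j < t by rewrite ij /=.
have [wj|wj] := boolP (w i j \in ball A (x (nth 0 s j)) d).
  have : w i j \in ball A (x (nth 0 s i)) d.+1 by rewrite wN ?eqxx.
  case/ballSP => [wi|[u [ui _ uw]]].
    by have := sI _ _ _ wi wj => eij; rewrite eij ltnn in ij.
  by exists u, (w i j); rewrite !in_setU ui wj.
have : w i j \in ball A (x (nth 0 s j)) d.+1 by rewrite wN ?eqxx ?orbT.
case/ballSP => [wj'|[u [uj _ uw]]]; first by rewrite wj' in wj.
exists (w i j), u; rewrite !in_setU uj edge_sym; split=> //.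
by apply/orP; right; apply/imsetP; exists j; rewrite // inE ij wj.
Qed.

(** Scattered balls are disjoint, so at most one index has to be dropped. *)
Lemma scatter_avoid_ball (G : sgraph) (A : {set G}) x d s v :
  uniq s -> scattered A x d s -> exists s', [/\ subseq s' s, (size s).-1 <= size s' &
    {in s', forall i, v \notin ball A (x i) d}].
Proof.
move=> us sc; case: (boolP (has (fun i => v \in ball A (x i) d) s)); last first.
  by rewrite -all_predC => /allP nv; exists s; split=> //; apply: leq_pred.
case/hasP => i si vi; exists (rem i s); split; [exact: rem_subseq| by rewrite size_rem |].
move=> j; rewrite mem_rem_uniq // !inE => /andP[ji sj].
by apply: contra ji => vj; apply/eqP; apply: sc vj vi.
Qed.

Section Step.
Variables (G : sgraph) (A : {set G}) (x : nat -> G) (d : nat).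

(** [S] will hold the vertices already known to touch all balls; avoiding it makes the picked vertex
    a new one. [common_near] still uses balls in [A], since bicliques and subdivided cliques are
    sought in [A]. *)
Definition common (S : {set G}) i j : option G :=
  [pick v in ball (A :\: S) (x i) d.+1 :&: ball (A :\: S) (x j) d.+1].

Definition common_near S i j l : bool :=
  if common S i j is Some v then v \in ball A (x l) d.+1 else false.

Definition triple_color S i j l : bool * bool * bool * bool :=
  (isSome (common S i j), common_near S i j l, common_near S i l j, common_near S j l i).

Lemma commonP S i j v : common S i j = Some v ->
  [/\ v \in A :\: S, v \in ball A (x i) d.+1 & v \in ball A (x j) d.+1].
Proof.
rewrite /common; case: pickP => // u; rewrite in_setI => /andP[ui uj] [<-].
by rewrite (ball_sub ui); split=> //; apply: ballS (subsetDl A S) _.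
Qed.

Lemma common_nearP S i j l : common_near S i j l ->
  exists2 v, common S i j = Some v & v \in ball A (x l) d.+1.
Proof. by rewrite /common_near; case: common => // v; exists v. Qed.

End Step.

(* The vertices of ws touch all the balls; t of them would form a biclique, so
   ws can be extended at most p more times. *)
Lemma scatter_step_aux d t m p : p <= t -> exists n, forall G, shallow_free d.+1 t G ->
  forall (A : {set G}) x s ws, uniq s -> uniq ws -> size ws = t - p -> n <= size s ->
  scattered A x d s ->
  (forall w i, w \in ws -> i \in s ->
     w \in ball A (x i) d.+1 /\ w \notin ball A (x i) d) ->
  exists s' (S : {set G}), [/\ subseq s' s, m <= size s', #|S| <= t &
    scattered (A :\: S) x d.+1 s'].
Proof.
elim: p => [_|p IH pt].
  exists t => G Gfree A x s ws us uws; rewrite subn0 => wst ts sc touch.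
  by have := biclique_not_free us uws ts wst sc touch.
have [n IHn] := IH (ltnW pt).
(* Three indices may be lost, two to the pair defining a common vertex and one to the ball
   containing it, and [n] must remain. Pairs among the first [m] or [t.+1] positions need a later
   position to complete a triple. *)
pose K := m + t + n + 4; have [N HN] := ramsey3 (bool * bool * bool * bool)%type K.
exists N => G Gfree A x s ws us uws wst Ns sc touch.
pose S := [set w in ws].
pose concl := exists s' (S : {set G}), [/\ subseq s' s, m <= size s', #|S| <= t &
  scattered (A :\: S) x d.+1 s'].
have [c [s1 [s1s s1K col]]] := HN (triple_color A x d S) s Ns.
have us1 := subseq_uniq s1s us.
(* A vertex touching more than [n] balls joins [ws], once the ball that contains it, if any, is
   dropped; the induction hypothesis then applies. *)
have grow v T : v \in A :\: S -> subseq T s1 -> n < size T ->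
    {in T, forall i, v \in ball A (x i) d.+1} ->
    concl.
  rewrite !inE => /andP[vws vA] Ts1 nT vT.
  have Ts := subseq_trans Ts1 s1s; have uT := subseq_uniq Ts us.
  have scT : scattered A x d T by apply: scattered_sub sc => //; apply: mem_subseq.
  have [T' [T'T sT' vT']] := scatter_avoid_ball v uT scT.
  have T's := subseq_trans T'T Ts.
  have [||||||s' [S' [s'T' ? ? ?]]] := IHn G Gfree A x T' (v :: ws).
  - exact: subseq_uniq T's us.
  - by rewrite /= vws.
  - by rewrite /= wst subnSK.
  - by apply: leq_trans sT'; rewrite -ltnS (ltn_predK nT).
  - by apply: scattered_sub sc => //; apply: mem_subseq.
  - move=> w i; rewrite inE => /predU1P[->|wws] iT'; last first.
      by apply: touch => //; apply: mem_subseq T's _ iT'.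
    by split; [apply: vT; apply: mem_subseq T'T _ iT' | apply: vT'].
  by exists s', S'; split=> //; apply: subseq_trans T's.
case: c col => [[[c0 c1] c2] c3] col.
have {}col i j l : i < j -> j < l -> l < K -> [/\ isSome (common A x d S (nth 0 s1 i) (nth 0 s1 j)) = c0,
    common_near A x d S (nth 0 s1 i) (nth 0 s1 j) (nth 0 s1 l) = c1,
    common_near A x d S (nth 0 s1 i) (nth 0 s1 l) (nth 0 s1 j) = c2 &
    common_near A x d S (nth 0 s1 j) (nth 0 s1 l) (nth 0 s1 i) = c3].
  by move=> ij jl lK; have [] := col i j l ij jl lK.
have [n4K K4 m2K tK] : [/\ n + 4 <= K, 3 < K, m + 2 < K & t.+1 < K].
  by rewrite /K; split; lia.
(* If pairs have no common vertex, deleting the vertices of [ws] already makes the enlarged balls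
   disjoint. *)
case: c0 col => col; last first.
  have mK : m <= size s1 by rewrite s1K; lia.
  exists (take m s1), S; split.
  - by apply: subseq_trans s1s; apply: take_subseq.
  - by rewrite size_takel.
  - by rewrite /S cardsE (leq_trans (card_size _)) // wst leq_subr.
  suff dis i j v : i < j < m -> v \in ball (A :\: S) (x (nth 0 s1 i)) d.+1 ->
      v \in ball (A :\: S) (x (nth 0 s1 j)) d.+1 -> False.
    move=> _ _ v /(nthP 0)[i + <-] /(nthP 0)[j + <-].
    rewrite size_takel // => im jm; rewrite !nth_take // => vi vj.
    case: (ltngtP i j) => [ij|ji|->//].
      by case: (dis i j v); rewrite ?ij.
    by case: (dis j i v); rewrite ?ji.
  case/andP=> ij jm vi vj.
  have jK : j.+1 < K by lia.
  have [+ _ _ _] := col i j j.+1 ij (ltnSn j) jK.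
  by rewrite /common; case: pickP => // /(_ v); rewrite in_setI vi vj.
(* In each of the three cases a single vertex touches all but boundedly many
   balls, namely the common neighbor of the first two, of the first and the
   last, or of the last two. *)
have near_c1 : c1 -> concl.
  move=> c1T; have [+ _ _ _] := col 0 1 2 isT isT (ltnW K4).
  case E : common => [v|] // _; have [vS _ _] := commonP E.
  apply: (grow v (drop 2 s1)) => //; first exact: drop_subseq.
    by rewrite size_drop s1K; lia.
  move=> _ /(nthP 0)[l + <-]; rewrite size_drop s1K nth_drop ltn_subRL => lK.
  have [_ + _ _] := col 0 1 (2 + l) isT isT lK.
  by rewrite /common_near E c1T.
have near_c2 : c2 -> concl.
  move=> c2T.
  (* [c0] is silent on pairs ending at the last position, so the common vertex is obtained from
     [c2], with position 1 in the middle. *)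
  have [v E _] : exists2 v, common A x d S (nth 0 s1 0) (nth 0 s1 K.-1) = Some v &
      v \in ball A (x (nth 0 s1 1)) d.+1.
    apply: common_nearP; have [||_ _ -> //] := col 0 1 K.-1 isT.
      by lia.
    by lia.
  have [vS _ _] := commonP E.
  apply: (grow v (drop 1 (take K.-1 s1))) => //.
  - by apply: subseq_trans (take_subseq _ _); apply: drop_subseq.
  - rewrite size_drop size_takel ?s1K ?leq_pred //; lia.
  move=> _ /(nthP 0)[l + <-].
  rewrite size_drop size_takel ?s1K ?leq_pred // ltn_subRL => lK.
  rewrite nth_drop nth_take //.
  have [|_ _ + _] := col 0 (1 + l) K.-1 isT lK; first by lia.
  by rewrite /common_near E c2T.
have near_c3 : c3 -> concl.
  move=> c3T; have [K2 gt0] : (K - 2).+1 < K /\ 0 < K - 2 by lia.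
  have [v E _] : exists2 v, common A x d S (nth 0 s1 (K - 2)) (nth 0 s1 (K - 2).+1) = Some v &
      v \in ball A (x (nth 0 s1 0)) d.+1.
    by apply: common_nearP; have [_ _ _ ->] := col 0 (K - 2) (K - 2).+1 gt0 (ltnSn _) K2.
  have [vS _ _] := commonP E.
  apply: (grow v (take (K - 2) s1)) => //; first exact: take_subseq.
    by rewrite size_takel ?s1K ?leq_subr //; lia.
  move=> _ /(nthP 0)[l + <-]; rewrite size_takel ?s1K ?leq_subr // => lK.
  rewrite nth_take //; have [_ _ _ +] := col l (K - 2) (K - 2).+1 lK (ltnSn _) K2.
  by rewrite /common_near E c3T.
case: c1 near_c1 col => [/(_ isT)//|_]; case: c2 near_c2 => [/(_ isT)//|_].
case: c3 near_c3 => [/(_ isT)//|_] col.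
(* Common vertices now touch no third ball, so they subdivide the edges of a clique on [t] balls.
   The range [t.+1] lets position [t - 1] start a pair, which puts its center in [A]. *)
pose w i j := odflt (x 0) (common A x d S (nth 0 s1 i) (nth 0 s1 j)).
have wS i j : i < j < t.+1 -> common A x d S (nth 0 s1 i) (nth 0 s1 j) = Some (w i j).
  case/andP=> ij jt; have [+ _ _ _] := col i j j.+1 ij (ltnSn j) (leq_ltn_trans jt tK).
  by rewrite /w; case: common.
have [] := @subdivision_not_free G A d t x s1 w; rewrite ?s1K ?(ltnW (ltnW tK)) //.
- by apply: scattered_sub sc => //; apply: mem_subseq.
- move=> i it; have i1 : i < i.+1 < t.+1 by rewrite ltnSn ltnS.
  by have [_ /ball_center_in] := commonP (wS _ _ i1).
move=> i j l /andP[ij jt] lt; have ijt : i < j < t.+1 by rewrite ij ltnW.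
have Ew := wS _ _ ijt; have [_ wi wj] := commonP Ew.
have [->//|li] := eqVneq l i; have [->|lj] := eqVneq l j; first by rewrite wj.
have E : (w i j \in ball A (x (nth 0 s1 l)) d.+1) =
  common_near A x d S (nth 0 s1 i) (nth 0 s1 j) (nth 0 s1 l) by rewrite /common_near Ew.
have ltK a : a < t -> a < K by move=> /ltn_trans -> //; apply: ltnW.
rewrite E; case: (ltngtP l i) => [l_i|i_l|e_li]; last by rewrite e_li eqxx in li.
  by have [_ _ _ ->] := col l i j l_i ij (ltK j jt).
case: (ltngtP l j) => [l_j|j_l|e_lj]; last by rewrite e_lj eqxx in lj.
  by have [_ _ -> _] := col i l j i_l l_j (ltK j jt).
by have [_ -> _ _] := col i j l ij j_l (ltK l lt).
Qed.

Lemma scatter_step d t m : exists n, forall G, shallow_free d.+1 t G ->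
  forall (A : {set G}) x s, uniq s -> n <= size s -> scattered A x d s ->
  exists s' (S : {set G}), [/\ subseq s' s, m <= size s', #|S| <= t &
    scattered (A :\: S) x d.+1 s'].
Proof.
have [n Hn] := @scatter_step_aux d t m t (leqnn t); exists n => G Gf A x s us ns sc.
by apply: (Hn G Gf A x s [::]); rewrite ?subnn.
Qed.

(* q must not depend on m: m is later chosen in terms of q, in order to
   pigeonhole the distances to S. *)
Lemma quasi_wide (C : sgraph -> Prop) d : nowhere_dense C ->
  exists q, forall m, exists n, forall G, C G -> forall (x : nat -> G) s, uniq s -> n <= size s ->
  exists s' (S : {set G}), [/\ subseq s' s, m <= size s', #|S| <= q &
    scattered (~: S) x d s'].
Proof.
move=> hC; elim: d => [|d [q IH]].
  (* At radius 0 only repeated centers matter: the selected centers are all distinct, or all equal,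
     and then deleting that one vertex empties the balls. *)
  exists 1 => m; have [n Hn] := ramsey2 bool m; exists n => G _ x s us ns.
  have [c [s' [s's s'm col]]] := Hn (fun i j => x i == x j) s ns.
  have us' := subseq_uniq s's us.
  suff [S S1 sc] : exists2 S : {set G}, #|S| <= 1 &
      forall p q, p < q < m -> x (nth 0 s' p) = x (nth 0 s' q) -> x (nth 0 s' p) \in S.
    exists s', S; rewrite s'm; split=> // _ _ v /(nthP 0)[p + <-] /(nthP 0)[q + <-].
    rewrite s'm !ball0E !inE => pm qm /andP[vS /eqP vp] /andP[_ /eqP vq].
    case: (ltngtP p q) => [pq|qp|->//].
      by have := sc p q; rewrite pq qm -vp -vq (negPf vS) => /(_ isT erefl).
    by have := sc q p; rewrite qp pm -vp -vq (negPf vS) => /(_ isT erefl).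
  case: c col => col; last first.
    exists set0; first by rewrite cards0.
    by move=> p q /col /eqP.
  exists [set x (nth 0 s' 0)]; first by rewrite cards1.
  move=> [|p] q /andP[pq qm] _; first exact: set11.
  by have /eqP-> := col 0 p.+1 (ltn_trans pq qm); rewrite set11.
have [t Ht] := hC d.+1; exists (q + t) => m; have [n1 Hn1] := scatter_step d t m.
have [n IHn] := IH n1; exists n => G CG x s us ns.
have [s1 [S1 [s1s n1s S1q sc1]]] := IHn G CG x s us ns.
have [s2 [S2 [s2s ms S2t sc2]]] := Hn1 G (Ht G CG) _ x s1 (subseq_uniq s1s us) n1s sc1.
exists s2, (S1 :|: S2); split=> //; first exact: subseq_trans s1s.
  by rewrite cardsU (leq_trans (leq_subr _ _)) // leq_add.
by rewrite setCU -setDE.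
Qed.

(** The coordinates are treated in turn: further deletions and passing to a subsequence keep the
    coordinates already treated scattered. *)
Lemma quasi_wide_diag (C : sgraph -> Prop) d k : nowhere_dense C ->
  exists q, forall m, exists n, forall G, C G -> forall (x : nat -> nat -> G) s, uniq s -> n <= size s ->
  exists s' (S : {set G}), [/\ subseq s' s, m <= size s', #|S| <= q &
    forall a, a < k -> scattered (~: S) (x a) d s'].
Proof.
move=> hC; elim: k => [|k [q1 IH]].
  by exists 0 => m; exists m => G _ x s _ ms; exists s, set0; rewrite cards0.
have [q2 Hq2] := quasi_wide d hC; exists (q2 + q1) => m.
have [n1 Hn1] := IH m; have [n2 Hn2] := Hq2 n1; exists n2 => G CG x s us ns.
have [s2 [S2 [s2s n1s S2q sc2]]] := Hn2 G CG (x k) s us ns.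
have [s1 [S1 [s1s ms S1q sc1]]] := Hn1 G CG x s2 (subseq_uniq s2s us) n1s.
exists s1, (S2 :|: S1); split=> //; first exact: subseq_trans s2s.
  by rewrite cardsU (leq_trans (leq_subr _ _)) // leq_add.
move=> a; rewrite ltnS leq_eqVlt => /predU1P[->|ak].
  by apply: scattered_sub sc2; rewrite ?setCS ?subsetUl //; apply: mem_subseq.
by apply: scattered_sub (sc1 a ak); rewrite ?setCS ?subsetUr.
Qed.

(* Cross pairs: if the balls around x a i and x b j met for all i < j, then x b j
   would be near two centers x a i. *)
Lemma quasi_wide_tuples (C : sgraph -> Prop) d k : nowhere_dense C ->
  exists q, forall m, exists n, forall G, C G -> forall (x : nat -> nat -> G) s, uniq s -> n <= size s ->
  exists s' (S : {set G}), [/\ subseq s' s, size s' = m, #|S| <= q &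
    forall a b i j v, a < k -> b < k -> i \in s' -> j \in s' ->
      v \in ball (~: S) (x a i) d -> v \in ball (~: S) (x b j) d -> i = j].
Proof.
(* If two balls of radius [d] meet, each center is within [d + d] of the other. The contradiction
   uses three positions, hence [m + 3]. *)
move=> hC; have [q Hq] := quasi_wide_diag (d + d) k hC; exists q => m.
have [N HN] := ramsey2 (option ('I_k * 'I_k)) (m + 3); have [n Hn] := Hq N.
exists n => G CG x s us ns; have [s1 [S [s1s Ns Sq sc]]] := Hn G CG x s us ns.
pose meet i j := [pick ab : 'I_k * 'I_k |
  [exists v, (v \in ball (~: S) (x ab.1 i) d) && (v \in ball (~: S) (x ab.2 j) d)]].
have [c [s2 [s2s s2m col]]] := HN meet s1 Ns.
have us2 := subseq_uniq s2s (subseq_uniq s1s us).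
case: c col => [[a b]|] col.
  have meetE p r : p < r < m + 3 -> nth 0 s2 r \in s2 /\
      x b (nth 0 s2 r) \in ball (~: S) (x a (nth 0 s2 p)) (d + d).
    move=> pr; split; first by rewrite mem_nth // s2m; case/andP: pr.
    have := col p r pr; rewrite /meet; case: pickP => // ab /existsP[v /andP[va vb]] [E].
    by move: va vb; rewrite E /= => va /ball_sym vb; apply: ball_trans va vb.
  have [_ x0] := meetE 0 2 ltac:(lia); have [_ x1] := meetE 1 2 ltac:(lia).
  have : nth 0 s2 0 = nth 0 s2 1.
    by apply: sc (ltn_ord a) _ _ _ _ _ x0 x1; apply: mem_subseq s2s _ _; rewrite mem_nth // s2m; lia.
  by move/eqP; rewrite nth_uniq // s2m; lia.
exists (take m s2), S; split=> //.
- by apply: subseq_trans (take_subseq _ _) _; apply: subseq_trans s1s.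
- by rewrite size_takel // s2m; lia.
have dis a b p r v : a < k -> b < k -> p < r < m + 3 ->
    v \in ball (~: S) (x a (nth 0 s2 p)) d -> v \in ball (~: S) (x b (nth 0 s2 r)) d -> False.
  move=> ak bk /col; rewrite /meet; case: pickP => // /(_ (Ordinal ak, Ordinal bk)) /= + _ va vb.
  by move/negbT/existsPn/(_ v); rewrite va vb.
move=> a b i j v ak bk /(nthP 0)[p + <-] /(nthP 0)[r + <-].
rewrite size_takel ?s2m; last by lia.
move=> pm rm; rewrite !nth_take // => va vb.
case: (ltngtP p r) => [pr|rp|->//].
  by case: (@dis a b p r v) => //; lia.
by case: (@dis b a r p v) => //; lia.
Qed.

(** * Dependence cores *)

Section Core.
Variables (r k : nat) (G : sgraph) (g0 : G).
Implicit Types (xs : seq (seq G)) (u v w : G) (Q : {set G}).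

(** This is dist(u, w) + dist(w, v) <= r, with [e] bounding the first distance. *)
Definition connector u v w : bool := [exists e : 'I_r.+1,
  (w \in ball [set: G] u e) && (w \in ball [set: G] v (r - e))].

Lemma connectorP u v w : reflect (exists d e, [/\ d + e <= r,
  w \in ball [set: G] u d & w \in ball [set: G] v e]) (connector u v w).
Proof.
apply: (iffP existsP) => [[d /andP[wu wv]]|[d [e [der wu wv]]]].
  by exists d, (r - d); split=> //; rewrite subnKC // -ltnS.
have dr : d < r.+1 by rewrite ltnS (leq_trans _ der) // leq_addr.
exists (Ordinal dr); rewrite /= wu; apply: ball_leq wv.
by rewrite leq_subRL // -ltnS.
Qed.

Definition coreb Q : bool := [forall X : {set G}, (#|X| == k) ==>
  [exists u in X, [exists v in X, (u != v) && [exists w in Q, connector u v w]]]].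

Lemma corebP Q : coreb Q -> dependence_core r k Q.
Proof.
move/forallP => core X /eqP Xk; have := core X; rewrite Xk /=.
case/existsP=> u /andP[uX /existsP[v /and3P[vX uv /existsP[w /andP[wQ]]]]].
case/connectorP=> d [e [der wu /ball_sym vw]].
have uT : u \in [set: G] by []; have wT : w \in [set: G] by [].
have /(ball_walkP _ _ uT)[p [/andP[up /eqP lp] pd _]] := wu.
have /(ball_walkP _ _ wT)[p' [/andP[wp' /eqP lp'] pe _]] := vw.
exists u, v, (p ++ p'); split=> //.
- by rewrite /walk cat_path last_cat up lp wp' lp' eqxx.
- by rewrite size_cat (leq_trans _ der) // leq_add.
by rewrite -[_ || _]/(has [in Q] (u :: p ++ p')); apply/hasP; exists w => //; rewrite -cat_cons mem_cat -lp mem_last.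
Qed.

Definition entry xs a i : G := nth g0 (nth [::] xs i) a.

(** A single vertex is picked for each pair of coordinates and triple of indices, which keeps
    [connectors] bounded. *)
Definition common_connector xs n (z : 'I_k * 'I_k * ('I_n * 'I_n * 'I_n)) : option G :=
  [pick w | all (fun i => connector (entry xs z.1.1 i) (entry xs z.1.2 i) w)
              [:: val z.2.1.1; val z.2.1.2; val z.2.2]].

Definition connectors xs : {set G} :=
  [set w | [exists z, common_connector xs (n := size xs) z == Some w]].

Lemma card_connectors xs : #|connectors xs| <= #|{: 'I_k * 'I_k * ('I_(size xs) * 'I_(size xs) * 'I_(size xs))}|.
Proof.
pose h z := odflt g0 (common_connector xs (n := size xs) z).
apply: (@leq_trans #|h @: setT|); last by rewrite (leq_trans (leq_imset_card _ _)) // cardsT.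
apply: subset_leq_card; apply/subsetP => w; rewrite inE => /existsP[z /eqP zw].
by apply/imsetP; exists z; rewrite // /h zw.
Qed.

(** The k-sets are kept as duplicate-free sequences, so that their elements have coordinates. *)
Definition evading xs : Prop := forall j, j < size xs ->
  [/\ uniq (nth [::] xs j), size (nth [::] xs j) = k &
    forall a b w, a < k -> b < k -> a != b -> w \in connectors (take j xs) ->
      ~~ connector (entry xs a j) (entry xs b j) w].

(** Greedy choice: while the connectors of the sets chosen so far are not a core, a k-set that they
    fail to connect is appended. *)
Lemma core_or_evading N p : k * k * (N * N * N) <= p ->
  (exists Q, dependence_core r k Q /\ #|Q| <= p) \/
  (exists2 xs, size xs = N & evading xs).
Proof.
move=> Np; suff IH n : n <= N ->
  (exists Q, dependence_core r k Q /\ #|Q| <= p) \/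
  (exists2 xs, size xs = n & evading xs) by apply: IH.
elim: n => [_|n IH nN]; first by right; exists [::].
have [|[xs xsn ev]] := IH (ltnW nN); first by left.
have Qp : #|connectors xs| <= p.
  apply: leq_trans (card_connectors xs) _; rewrite !card_prod !card_ord xsn.
  by apply: leq_trans Np; rewrite leq_mul // !leq_mul // ltnW.
have [/corebP core|] := boolP (coreb (connectors xs)); first by left; exists (connectors xs).
rewrite negb_forall => /existsP[X]; rewrite negb_imply => /andP[/eqP Xk /existsPn Xno].
right; exists (rcons xs (enum X)); first by rewrite size_rcons xsn.
move=> j; rewrite size_rcons ltnS leq_eqVlt /entry => /predU1P[->|jxs]; last first.
  by rewrite !nth_rcons jxs -cats1 takel_cat ?(ltnW jxs) //; apply: ev.
rewrite !nth_rcons ltnn eqxx -cats1 take_size_cat // enum_uniq -cardE; split=> //.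
move=> a b w ak bk ab wQ; set u := nth g0 _ a; set v := nth g0 _ b.
have uX : u \in X by rewrite -mem_enum mem_nth // -cardE Xk.
have vX : v \in X by rewrite -mem_enum mem_nth // -cardE Xk.
have uv : u != v by rewrite nth_uniq ?enum_uniq // -cardE Xk.
have := Xno u; rewrite uX => /existsPn/(_ v); rewrite vX uv => /existsPn/(_ w).
by rewrite wQ.
Qed.

(** The vertex [v] only guarantees that some vertex was picked for these indices; the one picked may
    differ from it. *)
Lemma connectors_common xs j a b i1 i2 i3 v : j <= size xs -> a < k -> b < k ->
  i1 < j -> i2 < j -> i3 < j ->
  {in [:: i1; i2; i3], forall i, connector (entry xs a i) (entry xs b i) v} ->
  exists2 w, w \in connectors (take j xs) &
    {in [:: i1; i2; i3], forall i, connector (entry xs a i) (entry xs b i) w}.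
Proof.
move=> jxs ak bk; rewrite -{1 2 3}(size_takel jxs) => l1 l2 l3 conn.
pose z := (Ordinal ak, Ordinal bk, (Ordinal l1, Ordinal l2, Ordinal l3)).
have entE c i : i \in [:: i1; i2; i3] -> entry (take j xs) c i = entry xs c i.
  move=> iI; rewrite /entry nth_take //.
  by move: iI; rewrite !inE => /or3P[] /eqP ->; rewrite -(size_takel jxs).
pose near w i := connector (entry (take j xs) a i) (entry (take j xs) b i) w.
have nearv : all (near v) [:: i1; i2; i3].
  by apply/allP => i iI; rewrite /near !entE //; apply: conn.
have : isSome (common_connector (take j xs) z).
  by rewrite /common_connector; case: pickP => // /(_ v)/negP[].
case E : (common_connector (take j xs) z) => [w|//] _.
exists w; first by rewrite inE; apply/existsP; exists z; rewrite E.
have /allP nearw : all (near w) [:: i1; i2; i3].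
  by move: E; rewrite /common_connector; case: pickP => // w' Hw [<-].
by move=> i iI; rewrite -!entE //; apply: nearw.
Qed.

End Core.

(** * Diagonal sets, distance profiles and the final argument *)

Lemma independent_or_close r k (G : sgraph) (y : nat -> G) :
  ~ (exists A : {set G}, distance_independent r A /\ #|A| = k) ->
  exists a b, [/\ a < k, b < k, a != b & y b \in ball [set: G] (y a) r].
Proof.
have [/existsP[a /existsP[b /andP[ab yab]]] _|] :=
  boolP [exists a : 'I_k, exists b : 'I_k, (a != b) && (y b \in ball [set: G] (y a) r)].
  by exists a, b; rewrite !ltn_ord.
rewrite negb_exists => /forallP far []; exists [set y a | a : 'I_k].
have {}far (a b : 'I_k) : a != b -> y b \notin ball [set: G] (y a) r.
  by move=> ab; have := far a; rewrite negb_exists => /forallP/(_ b); rewrite ab.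
split; last first.
  (* Equal values would be at distance 0, so [y] is injective on the first [k] indices. *)
  rewrite card_imset ?card_ord // => a b yab; apply/eqP; apply: contraT => /far.
  by rewrite yab ball_center ?inE.
move=> _ _ /imsetP[a _ ->] /imsetP[b _ ->] yab; apply: ball_dist_gt; apply: far.
by apply: contra_neq yab => ->.
Qed.

(** Pigeonhole: the profile of an index is a color from a finite set that depends on [r], [k] and
    [q] only. *)
Lemma same_profiles r k m q : exists n, forall (G : sgraph) (x : nat -> nat -> G) (S : {set G}) s,
  #|S| <= q -> n <= size s -> exists s', [/\ subseq s' s, size s' = m &
    forall a d u i j, a < k -> d <= r -> u \in S -> i \in s' -> j \in s' ->
      u \in ball [set: G] (x a i) d -> u \in ball [set: G] (x a j) d].
Proof.
have [n Hn] := ramsey1 {ffun 'I_k * 'I_q * 'I_r.+1 -> bool} m.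
exists n => G x S s Sq ns.
(* Positions beyond [#|S|] give the default [x 0 0]; they are never read, since [index u (enum S)]
   is below [#|S|]. *)
have [c [s' [s's s'm col]]] := Hn (fun i => [ffun z : 'I_k * 'I_q * 'I_r.+1 =>
  nth (x 0 0) (enum S) z.1.2 \in ball [set: G] (x z.1.1 i) z.2]) s ns.
exists s'; split=> // a d u i j ak dr uS is' js'.
have ue : u \in enum S by rewrite mem_enum.
have uq : index u (enum S) < q by rewrite (leq_trans _ Sq) // cardE index_mem.
have /ffunP/(_ (Ordinal ak, Ordinal uq, Ordinal (dr : d < r.+1))) := etrans (col i is') (esym (col j js')).
by rewrite !ffunE /= nth_index // => ->.
Qed.

Theorem theorem36 (r k : nat) (C : sgraph -> Prop) (hC : nowhere_dense C) :
  exists p : nat, forall G : sgraph, C G ->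
    ~ (exists A : {set G}, distance_independent r A /\ #|A| = k) ->
    exists Q : {set G}, dependence_core r k Q /\ #|Q| <= p.
Proof.
have [k0|k_gt0] := posnP k.
  exists 0 => G _ []; exists set0; rewrite cards0 k0; split=> // u v.
  by rewrite inE.
have [q Hq] := quasi_wide_tuples r k hC.
(* The diagonal set takes up [k] positions and the final contradiction four. *)
have [n Hn] := same_profiles r k (k + 4) q; have [N HN] := Hq n.
exists (k * k * (N * N * N)) => G CG no_indep.
have [g0|G0] := pickP G; last first.
  exists set0; rewrite cards0; split=> // X Xk.
  by move: k_gt0; rewrite -Xk card_gt0 => /set0Pn[u]; have := G0 u.
have [//|[xs xsN ev]] := core_or_evading r g0 (leqnn (k * k * (N * N * N))).
pose x := entry g0 xs.
have [|s1 [S [s1N s1n Sq far]]] := HN G CG x (iota 0 N) (iota_uniq 0 N).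
  by rewrite size_iota.
have [|s [ss1 sk prof]] := Hn G x S s1 Sq; first by rewrite s1n.
have s_lt : {in s, forall i, i < size xs}.
  by move=> i /(mem_subseq ss1)/(mem_subseq s1N); rewrite mem_iota xsN.
have far_s a b i j v : a < k -> b < k -> i \in s -> j \in s ->
    v \in ball (~: S) (x a i) r -> v \in ball (~: S) (x b j) r -> i = j.
  by move=> ak bk /(mem_subseq ss1) i1 /(mem_subseq ss1) j1; apply: far.
have s_sorted : sorted ltn s.
  apply: subseq_sorted ltn_trans _ _ (subseq_trans ss1 s1N) (iota_ltn_sorted 0 N).
have sP l : l < k + 4 -> nth 0 s l \in s by move=> lk; rewrite mem_nth ?sk.
have s_inj l l' : l < k + 4 -> l' < k + 4 -> nth 0 s l = nth 0 s l' -> l = l'.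
  move=> lk l'k /eqP; rewrite nth_uniq ?sk // => [/eqP//|].
  exact: sorted_uniq ltn_trans ltnn _ s_sorted.
have s_ltn l l' : l < l' < k + 4 -> nth 0 s l < nth 0 s l'.
  move=> /andP[ll' l'k]; apply: (sorted_ltn_nth ltn_trans) => //; rewrite inE sk //.
  exact: ltn_trans l'k.
have [a [b [ak bk ab yab]]] := independent_or_close (fun a => x a (nth 0 s a)) no_indep.
have [ak4 bk4] : a < k + 4 /\ b < k + 4 by lia.
have [u u_conn] : exists u, {in s, forall i, connector r (x a i) (x b i) u}.
  (* In G - S the connection would place one vertex in the balls of two different tuples. So it
     passes through some [u] in [S], and [prof] carries its distances over to all tuples. *)
  case: (ball_avoid S yab) => [yab'|[u [d1 [d2 [uS d12 ya /ball_sym yb]]]]].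
    have := far_s _ _ _ _ _ ak bk (sP _ ak4) (sP _ bk4) yab'.
    rewrite ball_center ?(ball_sub yab') // => /(_ isT) /(s_inj _ _ ak4 bk4) eab.
    by rewrite eab eqxx in ab.
  exists u => i si; apply/connectorP; exists d1, d2; split=> //.
    by apply: prof ak _ uS (sP _ ak4) si ya; lia.
  by apply: prof bk _ uS (sP _ bk4) si yb; lia.
(* The vertex w common to the first three tuples was available when the tuple i3
   was chosen.  In G - S it is close to at most one of the three in each of the
   coordinates a and b, so for one of the three its distances are realized
   through S, hence are the same for i3. *)
pose i0 := nth 0 s 0; pose i1 := nth 0 s 1; pose i2 := nth 0 s 2; pose i3 := nth 0 s 3.
have i3s : i3 \in s by apply: sP; lia.
have I_s : {subset [:: i0; i1; i2] <= s}.
  by move=> i; rewrite !inE => /or3P[] /eqP ->; apply: sP; lia.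
have [||||w wQ w_conn] := @connectors_common r k G g0 xs i3 a b i0 i1 i2 u (ltnW (s_lt _ i3s)) ak bk.
- by apply: s_ltn; lia.
- by apply: s_ltn; lia.
- by apply: s_ltn; lia.
- by move=> i /I_s; apply: u_conn.
have [_ _ /(_ a b w ak bk ab wQ) /connectorP[]] := ev i3 (s_lt _ i3s).
pose near c i := w \in ball (~: S) (x c i) r.
have [i iI /norP[na nb]] : exists2 i, i \in [:: i0; i1; i2] & ~~ (near a i || near b i).
  apply/hasP; apply: contraT; rewrite -all_predC /= !negbK.
  have near_inj c l l' : c < k -> l < l' < 3 -> near c (nth 0 s l) -> near c (nth 0 s l') -> False.
    move=> ck /andP[ll' l'3] nl nl'.
    have /s_inj := far_s _ _ _ _ _ ck ck (sP l ltac:(lia)) (sP l' ltac:(lia)) nl nl'.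
    by move=> /(_ ltac:(lia) ltac:(lia)) e; rewrite e ltnn in ll'.
  have n01 c ck := near_inj c 0 1 ck isT; have n02 c ck := near_inj c 0 2 ck isT.
  have n12 c ck := near_inj c 1 2 ck isT.
  move: (n01 a ak) (n01 b bk) (n02 a ak) (n02 b bk) (n12 a ak) (n12 b bk).
  rewrite -/i0 -/i1 -/i2.
  move: (near a i0) (near a i1) (near a i2) (near b i0) (near b i1) (near b i2).
  (* If each of three indices were near in one of two coordinates, two of them would share a
     coordinate. *)
  move=> [] [] [] [] [] [] //= h1 h2 h3 h4 h5 h6; exfalso;
    by [exact: h1 | exact: h2 | exact: h3 | exact: h4 | exact: h5 | exact: h6].
have si := I_s _ iI; have /connectorP[d [e [der wa wb]]] := w_conn i iI.
have transfer c d' : c < k -> d' <= r -> ~~ near c i -> w \in ball [set: G] (x c i) d' ->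
    w \in ball [set: G] (x c i3) d'.
  move=> ck d'r nc wc; case: (ball_avoid S wc) => [wc'|[v [e1 [e2 [vS e12 vc wv]]]]].
    by rewrite /near (ball_leq d'r wc') in nc.
  apply: (ball_leq e12); apply: ball_trans wv.
  by apply: prof ck _ vS si i3s vc; lia.
by exists d, e; split=> //; apply: transfer => //; lia.
Qed.
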